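(* Consider the Birman-Ko-Lee (BKL) presentation of the braid group $B_3$. For each $x\in B_3$, $\ell_{\mathrm R}(x)=\ell(x)$; that is, the rational length of $x$ with respect to the BKL Garside structure equals the minimal length of an expression of $x$ as a product of BKL generators and their inverses.
   Context: The BKL monoid $BKL_N^+$ is the monoid generated by $a_{t,s}$, $1\le s<t\le N$, subject to the relations $a_{t,s}a_{r,q}=a_{r,q}a_{t,s}$ if $(t-r)(t-q)(s-r)(s-q)>0$, and $a_{t,s}a_{s,r}=a_{t,r}a_{t,s}=a_{s,r}a_{t,r}$ if $t>s>r$. It is a Garside monoid whose atoms are the $a_{t,s}$, its group of fractions is the braid group $B_N$ on $N$ strings, and its fundamental element is $\delta=a_{N,N-1}a_{N-1,N-2}\cdots a_{2,1}$. Here $N=3$, so the atoms are $a_{2,1},a_{3,2},a_{3,1}$, with relations $a_{3,2}a_{2,1}=a_{3,1}a_{3,2}=a_{2,1}a_{3,1}$, and $\delta=a_{3,2}a_{2,1}$. Write $M=BKL_3^+$, $G=B_3$, $M\subseteq G$. For $a,b\in M$, $a$ is a left divisor of $b$ if $ac=b$ for some $c\in M$, and $a\wedge b$ is the greatest common divisor with respect to left divisibility. Greedy normal form of $x\in M$: put $x_1=x$, $s_i=\delta\wedge x_i$, $x_{i+1}=s_i^{-1}x_i$, and let $n$ be minimal with $x_{n+1}=1$; then $x=s_1\cdots s_n$ (the leading factors may equal $\delta$). For each $x\in G$ there is a unique pair $(u,v)\in M\times M$ with $x=u^{-1}v$ and $u\wedge v=1$. If $s_1\cdots s_k$ and $p_1\cdots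 p_l$ are the greedy normal forms of $u$ and $v$ ($k=0$ or $l=0$ allowed), the rational normal form of $x$ is $(s_1\cdots s_k)^{-1}(p_1\cdots p_l)$. $\ell(x)$ is the minimal length of an expression of $x\in G$ as a product of elements of $A^{\pm1}$, where $A$ is the set of atoms of $M$. The rational length is $\ell_{\mathrm R}(x)=\sum_{i=1}^k\ell(s_i)+\sum_{j=1}^l\ell(p_j)$, where $(s_1\cdots s_k)^{-1}(p_1\cdots p_l)$ is the rational normal form of $x$. *)

(* Defs.v *)
From HB Require Import structures.
From mathcomp Require Import all_boot order ssralg ssrnum ssrint.
From mathcomp Require Import boolp classical_sets.

Set Implicit Arguments.
Unset Strict Implicit.
Unset Printing Implicit Defensive.

Local Open Scope quotient_scope.
Local Open Scope classical_set_scope.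
Local Open Scope group_scope.

Section PresentedMonoid.
Variables (X : choiceType) (R : seq X -> seq X -> Prop).

Inductive cong : seq X -> seq X -> Prop :=
| cong_rel u v of R u v : cong u v
| cong_refl u : cong u u
| cong_sym u v of cong u v : cong v u
| cong_trans u v w of cong u v & cong v w : cong u w
| cong_cat u u' v v' of cong u u' & cong v v' : cong (u ++ v) (u' ++ v').

Definition congb : rel (seq X) := fun u v => `[< cong u v >].

Lemma congb_refl : reflexive congb.
Proof. by move=> u; apply/asboolP/cong_refl. Qed.

Lemma congb_sym : symmetric congb.
Proof. by move=> u v; apply/asboolP/asboolP; apply: cong_sym. Qed.

Lemma congb_trans : transitive congb.
Proof.
by move=> v u w /asboolP uv /asboolP vw; apply/asboolP; exact: cong_trans uv vw.
Qed.

Canonical congb_equiv := EquivRel congb congb_refl congb_sym congb_trans.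

Definition pmonoid := {eq_quot congb}.

HB.instance Definition _ := Choice.on pmonoid.
HB.instance Definition _ := Quotient.on pmonoid.

Definition wclass (w : seq X) : pmonoid := \pi w.

Lemma wclassP u v : wclass u = wclass v <-> cong u v.
Proof. by split=> [/eqmodP/asboolP|h]; last by apply/eqmodP/asboolP. Qed.

Lemma wclass_repr (a : pmonoid) : wclass (repr a) = a.
Proof. exact: reprK. Qed.

Lemma cong_repr w : cong (repr (wclass w)) w.
Proof. by apply/wclassP; rewrite wclass_repr. Qed.

Definition pone : pmonoid := wclass [::].
Definition pmul (a b : pmonoid) : pmonoid := wclass (repr a ++ repr b).

Lemma pmulE u v : pmul (wclass u) (wclass v) = wclass (u ++ v).
Proof. by apply/wclassP/cong_cat; apply: cong_repr. Qed.

Lemma pmulA : associative pmul.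
Proof.
move=> a b c; rewrite -(wclass_repr a) -(wclass_repr b) -(wclass_repr c).
by rewrite !pmulE catA.
Qed.

Lemma pmul1g : left_id pone pmul.
Proof. by move=> a; rewrite -(wclass_repr a) pmulE. Qed.

Lemma pmulg1 : right_id pone pmul.
Proof. by move=> a; rewrite -(wclass_repr a) pmulE cats0. Qed.

HB.instance Definition _ := isMonoid.Build pmonoid pmulA pmul1g pmulg1.

End PresentedMonoid.

Section PresentedGroup.
Variables (X : choiceType) (R : seq X -> seq X -> Prop).

(* The letter (x, true) stands for x and (x, false) for its inverse. *)
Definition pos_word (w : seq X) : seq (X * bool) := [seq (x, true) | x <- w].

Inductive group_rel : seq (X * bool) -> seq (X * bool) -> Prop :=
| group_rel_pos u v of R u v : group_rel (pos_word u) (pos_word v)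
| group_rel_inv x e : group_rel [:: (x, e); (x, ~~ e)] [::].

Definition pgroup := pmonoid group_rel.

Definition flip_word (w : seq (X * bool)) : seq (X * bool) :=
  rev [seq (l.1, ~~ l.2) | l <- w].

Lemma flip_wordK : involutive flip_word.
Proof.
move=> w; rewrite /flip_word map_rev revK -map_comp -[RHS]map_id.
by apply: eq_map => -[x e]; rewrite /= negbK.
Qed.

Lemma cong_mulV w : cong group_rel (w ++ flip_word w) [::].
Proof.
elim/last_ind: w => [|w [x e] IH]; first exact: cong_refl.
rewrite /flip_word map_rcons rev_rcons -cats1 -catA /=.
apply: cong_trans IH; apply: cong_cat; first exact: cong_refl.
rewrite -[_ :: _ :: _]/([:: (x, e); (x, ~~ e)] ++ flip_word w).
rewrite -[X in cong _ _ X]/([::] ++ flip_word w).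
by apply: cong_cat; [apply/cong_rel/group_rel_inv | apply: cong_refl].
Qed.

Lemma cong_Vmul w : cong group_rel (flip_word w ++ w) [::].
Proof. by rewrite -{2}(flip_wordK w); apply: cong_mulV. Qed.

Definition pinv (a : pgroup) : pgroup := wclass group_rel (flip_word (repr a)).

HB.instance Definition _ := Monoid.on pgroup.
HB.instance Definition _ := hasInv.Build pgroup pinv.

Lemma pmulVg : left_inverse (1 : pgroup) pinv *%g.
Proof.
by move=> a; rewrite -{2}(wclass_repr a) [LHS]pmulE; apply/wclassP/cong_Vmul.
Qed.

Lemma pmulgV : right_inverse (1 : pgroup) pinv *%g.
Proof.
by move=> a; rewrite -{1}(wclass_repr a) [LHS]pmulE; apply/wclassP/cong_mulV.
Qed.

HB.instance Definition _ := Monoid_isGroup.Build pgroup pmulVg pmulgV.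

Definition to_group (a : pmonoid R) : pgroup :=
  wclass group_rel (pos_word (repr a)).

Lemma to_groupE w : to_group (wclass R w) = wclass group_rel (pos_word w).
Proof.
apply/wclassP; move: (cong_repr R w); move: (repr _) => w'.
elim=> {w w'}.
- by move=> u v /group_rel_pos; apply: cong_rel.
- by move=> u; apply: cong_refl.
- by move=> u v _; apply: cong_sym.
- by move=> u v w _ uv _; apply: cong_trans uv.
- by move=> u u' v v' _ uu' _ vv'; rewrite /pos_word !map_cat; apply: cong_cat.
Qed.

Lemma to_group_monoid_morphism : monoid_morphism to_group.
Proof.
split=> [|a b]; first exact: to_groupE.
rewrite -(wclass_repr a) -(wclass_repr b) [_ * wclass _ _]pmulE !to_groupE.
by rewrite [RHS]pmulE /pos_word map_cat.
Qed.

HB.instance Definition _ :=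
  isUMagmaMorphism.Build (pmonoid R) pgroup to_group to_group_monoid_morphism.

End PresentedGroup.

Section BKL.
Variable N : nat.

(* The pair (t, s) is the index of the generator a_{t,s}. *)
Definition bkl_index := {p : nat * nat | (0 < p.2 < p.1)%N && (p.1 <= N)%N}.

HB.instance Definition _ := Choice.on bkl_index.

Definition hi (a : bkl_index) : nat := (val a).1.
Definition lo (a : bkl_index) : nat := (val a).2.

Inductive bkl_rel : seq bkl_index -> seq bkl_index -> Prop :=
| bkl_comm (a b : bkl_index) of
    (0 < ((hi a)%:Z - (hi b)%:Z) * ((hi a)%:Z - (lo b)%:Z)
         * ((lo a)%:Z - (hi b)%:Z) * ((lo a)%:Z - (lo b)%:Z))%R :
    bkl_rel [:: a; b] [:: b; a]
(* t > s > r follows from the validity of the three indices. *)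
| bkl_triangle1 (ts sr tr : bkl_index) of
    hi tr = hi ts & lo ts = hi sr & lo sr = lo tr :
    bkl_rel [:: ts; sr] [:: tr; ts]
| bkl_triangle2 (ts sr tr : bkl_index) of
    hi tr = hi ts & lo ts = hi sr & lo sr = lo tr :
    bkl_rel [:: tr; ts] [:: sr; tr].

Definition bkl_monoid := pmonoid bkl_rel.
Definition braid := pgroup bkl_rel.

HB.instance Definition _ := Monoid.on bkl_monoid.
HB.instance Definition _ := Group.on braid.

Definition embed (a : bkl_monoid) : braid := to_group a.

Definition atom (i : bkl_index) : bkl_monoid := wclass bkl_rel [:: i].

(* delta = a_{N,N-1} a_{N-1,N-2} ... a_{2,1}; every pair listed is a valid
   index, so [pmap insub] discards nothing. *)
Definition delta : bkl_monoid :=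
  \prod_(i <- pmap insub [seq (s.+1, s) | s <- rev (iota 1 N.-1)]) atom i.

Implicit Types (a b d x : bkl_monoid) (g : braid).

Definition ldvd a b := exists c, a * c = b.

(* Each [xget] and [least] below singles out an object that exists and is unique
   because the monoid is Garside (respectively a least natural number), so its
   default value plays no role.  For [lquot a b] this presupposes [ldvd a b],
   which holds in its only use, [greedy_tail]. *)
Definition lgcd a b : bkl_monoid :=
  xget 1 [set d | [/\ ldvd d a, ldvd d b &
                     forall e, ldvd e a -> ldvd e b -> ldvd e d]].

Definition lquot a b : bkl_monoid := xget 1 [set c | a * c = b].

Definition least (P : nat -> Prop) : nat :=
  xget 0%N [set n | P n /\ forall m, P m -> (n <= m)%N].

Definition greedy_head x := lgcd delta x.
Definition greedy_tail x := lquot (greedy_head x) x.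

(* The successive remainders x_1 = x, x_2, ... are [iter i greedy_tail x],
   i = 0, 1, ... *)
Definition greedy_size x : nat := least (fun n => iter n greedy_tail x = 1).
Definition greedy_nf x : seq bkl_monoid :=
  [seq greedy_head (iter i greedy_tail x) | i <- iota 0 (greedy_size x)].

Definition irreducible_fraction g : bkl_monoid * bkl_monoid :=
  xget (1, 1) [set uv | g = (embed uv.1)^-1 * embed uv.2 /\ lgcd uv.1 uv.2 = 1].

Definition rational_nf g : seq bkl_monoid * seq bkl_monoid :=
  let uv := irreducible_fraction g in (greedy_nf uv.1, greedy_nf uv.2).

Definition signed_atom g : Prop :=
  exists i, g = embed (atom i) \/ g = (embed (atom i))^-1.

Definition len g : nat :=
  least (fun n => exists w : seq braid,
    [/\ size w = n, forall h, h \in w -> signed_atom h & \prod_(h <- w) h = g]).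

Definition rational_len g : nat :=
  (\sum_(s <- (rational_nf g).1) len (embed s)
   + \sum_(p <- (rational_nf g).2) len (embed p))%N.

End BKL.

(* Main.v *)
Require Import Defs.
From mathcomp Require Import all_boot all_algebra.
From mathcomp Require Import boolp classical_sets.
From mathcomp Require Import zify.

(** The defining relations of the BKL monoid are homogeneous, so word length
descends to a degree [deg] on the monoid and to an integer exponent sum on the
braid group.  The exponent sum forces a positive element to have length exactly
its degree ([len_embed]), and the factors of a greedy normal form have product
the element they come from; hence, if [g = u^-1 v] is the irreducible fraction
of [g], the rational length of [g] is [deg u + deg v] ([greedy_nf_len]).  That
this is an upper bound for the length of [g] is clear.

For the lower bound take N = 3 and let the atoms be [x_i], with [i] in Z/3 and
[x_i x_(i+1) = delta].  Every positive element is uniquely [delta^k] times a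
product of atoms along a word over Z/3 in which [i] is never followed by
[i + 1].  Allowing [k] in Z, the braid group acts by left multiplication on such
pairs [(k, w)], and an atom or its inverse changes the length of [w] by one
only.  The length of the word in the normal form of [g] is therefore at most
[len g] ([nf_size]).  If [u] and [v] are both nontrivial and have no common
atom on the left, then neither is divisible by [delta] (which every atom
divides), so both are given by words, with distinct first letters; acting with
[u^-1] on the word of [v] then never cancels a letter, and the normal form of
[u^-1 v] has a word of length [deg u + deg v] ([coprime_len]).  If [u] or [v]
is trivial, the exponent sum suffices.

The same normal forms show that the monoid embeds in the group, hence is left
cancellative, and that two distinct atoms dividing an element force [delta] to
divide it.  These two facts give the existence of left gcds ([ex_lgcd]), without
which the operations in the definition of the rational length would not be
meaningful. *)

Set Implicit Arguments.
Unset Strict Implicit.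
Unset Printing Implicit Defensive.

Import GRing.Theory.
Local Open Scope group_scope.

(** * Degree and length in BKL monoids and braid groups *)

Section DegreeAndLength.
Variable N : nat.
Implicit Types (p q u v x : bkl_monoid N) (g h : braid N).
Local Notation letter := (bkl_index N * bool)%type.
Local Notation grel := (group_rel (@bkl_rel N)).

Definition deg p : nat := size (repr p).

Lemma cong_size (w w' : seq (bkl_index N)) :
  cong (@bkl_rel N) w w' -> size w = size w'.
Proof.
elim=> // [? ? []//|? ? ? _ -> _ -> //|a a' b b' _ ha _ hb].
by rewrite !size_cat ha hb.
Qed.

Lemma deg_wclass w : deg (wclass (@bkl_rel N) w) = size w.
Proof. exact/cong_size/cong_repr. Qed.

Lemma degM p q : deg (p * q) = (deg p + deg q)%N.
Proof.
rewrite -(wclass_repr p) -(wclass_repr q) [_ * _]pmulE !deg_wclass.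
exact: size_cat.
Qed.

Lemma deg1 : deg 1 = 0%N. Proof. exact: deg_wclass. Qed.

Lemma deg_atom i : deg (atom i) = 1%N. Proof. exact: deg_wclass. Qed.

Lemma deg_eq0 p : deg p = 0%N -> p = 1.
Proof. by move/size0nil => p0; rewrite -(wclass_repr p) p0. Qed.

Lemma monoid_ind (P : bkl_monoid N -> Prop) :
  P 1 -> (forall i p, P p -> P (atom i * p)) -> forall p, P p.
Proof.
move=> P1 PM p; rewrite -(wclass_repr p).
elim: (repr p) => [//|i w IH].
by have := PM i _ IH; rewrite [_ * _]pmulE.
Qed.

Lemma atom_divisor p : p <> 1 -> exists i, ldvd (atom i) p.
Proof. by elim/monoid_ind: p => // i p _ _; exists i, p. Qed.

(** The exponent sum of a signed word. *)
Definition weight (w : seq letter) : int :=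
  (\sum_(l <- w) (if l.2 then 1 else -1))%R.

Lemma weight_cat w w' : weight (w ++ w') = (weight w + weight w')%R.
Proof. exact: big_cat. Qed.

Lemma weight_pos w : weight (pos_word w) = Posz (size w).
Proof.
rewrite /weight big_map big_const_seq count_predT iter_addr_0; lia.
Qed.

Lemma weight_flip w : weight (flip_word w) = (- weight w)%R.
Proof.
rewrite /weight /flip_word (perm_big _ (permEl (perm_rev _))) big_map -sumrN.
by apply: eq_bigr => -[i []].
Qed.

Lemma weight_size w : (`|weight w| <= size w)%N.
Proof.
elim: w => [|[i e] w IH]; first by rewrite /weight big_nil.
by move: IH; rewrite /weight big_cons; case: e => /=; lia.
Qed.

Lemma cong_weight w w' : cong grel w w' -> weight w = weight w'.
Proof.
elim=> // [a b [c d cd|i []]|? ? ? _ -> _ -> //|a a' b b' _ ha _ hb].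
- by rewrite !weight_pos (cong_size (cong_rel cd)).
- by rewrite /weight !big_cons big_nil.
- by rewrite /weight !big_cons big_nil.
- by rewrite !weight_cat ha hb.
Qed.

(** The class of a signed word, typed as a braid so that the group structure of
[braid N], and not just the monoid structure of the quotient, is found. *)
Definition word (w : seq letter) : braid N := wclass grel w.

Lemma wordM w w' : word w * word w' = word (w ++ w').
Proof. exact: pmulE. Qed.

Lemma wordV w : (word w)^-1 = word (flip_word w).
Proof.
apply: (mulgI (word w)); rewrite mulgV wordM.
exact/esym/wclassP/cong_mulV.
Qed.

Lemma word_repr g : word (repr g) = g. Proof. exact: wclass_repr. Qed.

Lemma signed_letter h :
  signed_atom h <-> exists l, h = word [:: l].
Proof.
have posE i : embed (atom i) = word [:: (i, true)].
  exact: (@to_groupE _ _ [:: i]).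
have negE i : (embed (atom i))^-1 = word [:: (i, false)].
  by rewrite posE wordV.
split=> [[i [->|->]]|[[i []] ->]].
- by exists (i, true).
- by exists (i, false).
- by exists i; left.
- by exists i; right.
Qed.

Lemma word_prod (w : seq letter) :
  word w = \prod_(l <- w) word [:: l].
Proof.
elim: w => [|l w IH]; first by rewrite big_nil.
by rewrite big_cons -IH wordM.
Qed.

Lemma leastP (P : nat -> Prop) :
  (exists n, P n) -> P (least P) /\ forall m, P m -> (least P <= m)%N.
Proof.
move=> exP.
have exb : exists n, `[< P n >] by have [n Pn] := exP; exists n; apply/asboolP.
apply: (@xgetPex _ 0%N [set n | P n /\ forall m, P m -> (n <= m)%N]%classic).
exists (ex_minn exb).
case: ex_minnP => n /asboolP Pn minn; split=> // m Pm.
exact/minn/asboolP.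
Qed.

(** Lists of signed atoms and signed words are the same thing, so the length can
be computed on the words that represent a braid. *)
Lemma lenP g : (exists2 w, word w = g & size w = len g) /\
  forall w, word w = g -> (len g <= size w)%N.
Proof.
pose P n := exists w : seq (braid N),
    [/\ size w = n, forall h, h \in w -> signed_atom h & \prod_(h <- w) h = g].
have Pword w : word w = g -> P (size w).
  move=> wg; exists [seq word [:: l] | l <- w]; split.
  - by rewrite size_map.
  - by move=> h /mapP[l _ ->]; apply/signed_letter; exists l.
  - by rewrite big_map -word_prod.
have [] : P (len g) /\ forall m, P m -> (len g <= m)%N.
  by apply: leastP; exists (size (repr g)); apply: Pword; apply: word_repr.
move=> [s [ss sg sprod]] minP; split=> [|w /Pword]; last exact: minP.
suff [w sw ws] : exists2 w, size w = size s &
    word w = \prod_(h <- s) h by exists w; rewrite ?ws ?sw.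
elim: s {ss sprod} sg => [|h s IH] sg; first by exists [::]; rewrite ?big_nil.
have [l ->] : exists l, h = word [:: l].
  by apply/signed_letter/sg; rewrite mem_head.
have [|w sw ws] := IH; first by move=> h' h's; apply: sg; apply: mem_behead.
by exists (l :: w); rewrite /= ?sw // big_cons -ws wordM.
Qed.

Lemma embed_wclass w :
  embed (wclass (@bkl_rel N) w) = word (pos_word w).
Proof. exact: to_groupE. Qed.

Lemma embedE p : embed p = word (pos_word (repr p)).
Proof. by []. Qed.

Lemma embed1 : embed (1 : bkl_monoid N) = 1.
Proof. by have [] := to_group_monoid_morphism (@bkl_rel N). Qed.

Lemma embedM p q : embed (p * q) = embed p * embed q.
Proof. have [_] := to_group_monoid_morphism (@bkl_rel N); exact. Qed.

Lemma fraction_word u v : (embed u)^-1 * embed v =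
  word (flip_word (pos_word (repr u)) ++ pos_word (repr v)).
Proof. by rewrite !embedE wordV wordM. Qed.

Lemma len_fraction_le u v :
  (len ((embed u)^-1 * embed v)%g <= deg u + deg v)%N.
Proof.
have [_ min_len] := lenP ((embed u)^-1 * embed v).
have /leq_trans := min_len _ (esym (fraction_word u v)).
by apply; rewrite size_cat size_rev !size_map.
Qed.

(** A braid is at least as long as the absolute value of its exponent sum. *)
Lemma len_fraction_ge u v :
  (`|Posz (deg v) - Posz (deg u)| <= len ((embed u)^-1 * embed v)%g)%N.
Proof.
have [[w wE <-] _] := lenP ((embed u)^-1 * embed v).
apply: leq_trans (weight_size w).
move: wE; rewrite fraction_word => /wclassP/cong_weight ->.
by rewrite weight_cat weight_flip !weight_pos /deg; lia.
Qed.

Lemma len_embed p : len (embed p) = deg p.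
Proof.
have := len_fraction_le 1 p; have := len_fraction_ge 1 p.
rewrite embed1 invg1 mul1g deg1; lia.
Qed.

Definition is_lgcd u v x :=
  [/\ ldvd x u, ldvd x v & forall y, ldvd y u -> ldvd y v -> ldvd y x].

Lemma lgcdP u v : (exists x, is_lgcd u v x) -> is_lgcd u v (lgcd u v).
Proof. by move=> ex; apply: (xgetPex 1 ex). Qed.

Lemma ldvd_trans u v x : ldvd u v -> ldvd v x -> ldvd u x.
Proof. by move=> [a <-] [b <-]; exists (a * b); rewrite mulgA. Qed.

Lemma ldvd_deg u v : ldvd u v -> (deg u <= deg v)%N.
Proof. by move=> [a <-]; rewrite degM leq_addr. Qed.

(** The greedy factors of [x] multiply up to [x] and a positive element has
length its degree.  The process stops because a nontrivial element has an atom on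
its left, which also divides [delta], so that the head is nontrivial and the
remainder has smaller degree. *)
Lemma greedy_nf_len x :
  (forall i, ldvd (atom i) (delta N)) ->
  (forall y, exists z, is_lgcd (delta N) y z) ->
  (\sum_(s <- greedy_nf x) len (embed s) = deg x)%N.
Proof.
move=> atom_delta ex_gcd.
have step (y : bkl_monoid N) : greedy_head y * greedy_tail y = y.
  by have [_ dvd_head _] := lgcdP (ex_gcd y); exact: (xgetPex 1 dvd_head).
have head_gt0 (y : bkl_monoid N) : y <> 1 -> (0 < deg (greedy_head y))%N.
  have [_ _ headP] := lgcdP (ex_gcd y).
  move=> /atom_divisor[i iy]; rewrite -(deg_atom i).
  exact/ldvd_deg/headP.
have sumE n y : (\sum_(i <- iota 0 n)
    deg (greedy_head (iter i (@greedy_tail N) y)) + deg (iter n (@greedy_tail N) y) = deg y)%N.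
  elim: n => [|n IH]; first by rewrite big_nil.
  rewrite -[n.+1]addn1 iotaD big_cat /= add0n big_seq1 addn1 -addnA.
  by rewrite iterS -degM step.
have [] : iter (greedy_size x) (@greedy_tail N) x = 1 /\
  forall m, iter m (@greedy_tail N) x = 1 -> (greedy_size x <= m)%N.
  apply: leastP; exists (deg x); apply: deg_eq0; apply/eqP.
  rewrite -leqn0 -(subnn (deg x)).
  elim: {1 3}(deg x) => [|n IH]; first by rewrite subn0.
  rewrite iterS; set y := iter n _ x in IH *.
  have := congr1 deg (step y); rewrite degM.
  have [->|/head_gt0] := pselect (y = 1); first rewrite deg1; lia.
move=> size1 _; rewrite /greedy_nf big_map -[RHS](sumE (greedy_size x)).
rewrite size1 deg1 addn0; apply: eq_bigr => i _; exact: len_embed.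
Qed.

End DegreeAndLength.

(** * The atoms of the BKL monoid on three strings *)

Lemma Z3_succ3 (i : 'Z_3) : (i + 1 + 1 + 1 = i)%R.
Proof. by apply/eqP; case: i => [[|[|[]]]]. Qed.

(** The atoms [a_(3,2)], [a_(2,1)], [a_(3,1)] in this cyclic order, in which the
product of two successive atoms is [delta]. *)
Definition gen_pair (i : 'Z_3) : nat * nat :=
  nth (3, 1)%N [:: (3, 2); (2, 1)]%N i.

Lemma gen_pairP i : 
  (0 < (gen_pair i).2 < (gen_pair i).1)%N && ((gen_pair i).1 <= 3)%N.
Proof. by case: i => [[|[|[]]]]. Qed.

Definition gen (i : 'Z_3) : bkl_index 3 := exist _ (gen_pair i) (gen_pairP i).

(** The sums of indices are 5, 3 and 4 for the generators numbered 0, 1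
and 2, whence the offset. *)
Definition code (a : bkl_index 3) : 'Z_3 := inZp (hi a + lo a).+1.

Lemma genK : cancel gen code.
Proof. by move=> i; apply/eqP; case: i => [[|[|[]]]]. Qed.

Lemma codeK : cancel code gen.
Proof.
case=> -[t s] ts; apply/val_inj => /=; rewrite /code /hi /lo /=.
have /= /andP[/andP[]] := ts.
by case: t {ts} => [|[|[|[|t]]]] //; case: s => [|[|[|s]]].
Qed.

(** Among the chords of a triangle no two are disjoint, so commutation relations
do not occur. *)
Lemma bkl_rel3 u v : @bkl_rel 3 u v ->
  exists i j, u = [:: gen i; gen (i + 1)%R] /\ v = [:: gen j; gen (j + 1)%R].
Proof.
case=> [a b|ts sr tr|ts sr tr].
- rewrite -(codeK a) -(codeK b); move: (code a) (code b).
  by case=> [[|[|[]]]] // ?; case=> [[|[|[]]]].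
- rewrite -(codeK ts) -(codeK sr) -(codeK tr).
  move: (code ts) (code sr) (code tr) => i j k ik ij jk.
  exists i, k; move: ik ij jk.
  case: i => [[|[|[]]]] // ?; case: j => [[|[|[]]]] // ?;
  case: k => [[|[|[]]]] // ? // _ _ _.
  by split; congr [:: _; _]; congr gen; apply: val_inj.
- rewrite -(codeK ts) -(codeK sr) -(codeK tr).
  move: (code ts) (code sr) (code tr) => i j k ik ij jk.
  exists k, j; move: ik ij jk.
  case: i => [[|[|[]]]] // ?; case: j => [[|[|[]]]] // ?;
  case: k => [[|[|[]]]] // ? // _ _ _.
  by split; congr [:: _; _]; congr gen; apply: val_inj.
Qed.

Local Notation M := (bkl_monoid 3).
Local Notation G := (braid 3).

Definition x_ (i : 'Z_3) : M := atom (gen i).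

Lemma x_mul i j : x_ i * x_ j = wclass (@bkl_rel 3) [:: gen i; gen j].
Proof. exact: pmulE. Qed.

Lemma delta3 : delta 3 = x_ 0%R * x_ 1%R.
Proof.
rewrite /delta /= -[(3, 2)%N]/(val (gen 0%R)) -[(2, 1)%N]/(val (gen 1%R)).
rewrite !valK /=.
by rewrite !big_cons big_nil mulg1.
Qed.

Lemma x_succ i : x_ i * x_ (i + 1)%R = delta 3.
Proof.
have r1 : x_ 0%R * x_ 1%R = x_ 2%R * x_ 0%R.
  rewrite !x_mul; apply/wclassP/cong_rel.
  exact: (@bkl_triangle1 3 (gen 0%R) (gen 1%R) (gen 2%R)).
have r2 : x_ 2%R * x_ 0%R = x_ 1%R * x_ 2%R.
  rewrite !x_mul; apply/wclassP/cong_rel.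
  exact: (@bkl_triangle2 3 (gen 0%R) (gen 1%R) (gen 2%R)).
rewrite delta3; case: i => [[|[|[]]]] // h.
- by congr (x_ _ * x_ _); apply: val_inj.
- by rewrite r1 r2; congr (x_ _ * x_ _); apply: val_inj.
- by rewrite r1; congr (x_ _ * x_ _); apply: val_inj.
Qed.

(** Both sides are [x_(i+1) x_(i+2) x_(i+3)], as indices are modulo 3. *)
Lemma x_delta i : x_ (i + 1)%R * delta 3 = delta 3 * x_ i.
Proof.
rewrite -{1}(x_succ (i + 1 + 1)%R) mulgA x_succ.
by rewrite -[in RHS](Z3_succ3 i).
Qed.

Lemma x_deltaX i k : x_ (i + k%:R)%R * delta 3 ^+ k = delta 3 ^+ k * x_ i.
Proof.
elim: k => [|k IH]; first by rewrite addr0 expg0 mulg1 mul1g.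
by rewrite expgS -natr1 addrA mulgA x_delta -!mulgA IH.
Qed.

Lemma x_dvd_delta i : ldvd (x_ i) (delta 3).
Proof. by exists (x_ (i + 1)%R); apply: x_succ. Qed.

Lemma x_ind (P : M -> Prop) :
  P 1 -> (forall i p, P p -> P (x_ i * p)) -> forall p, P p.
Proof.
by move=> P1 PM; elim/monoid_ind=> // a p; rewrite -(codeK a); apply: PM.
Qed.

Lemma x_divisor p : p <> 1 -> exists i, ldvd (x_ i) p.
Proof.
by move=> /atom_divisor[a]; rewrite -(codeK a) => ap; exists (code a).
Qed.

(** * The action of the braid group on normal forms *)

Definition reduced (w : seq 'Z_3) := sorted (fun i j => j != i + 1)%R w.

Definition state := (int * seq 'Z_3)%type.

(** The pair [(k, w)] stands for [delta^k] times the product of the atoms along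
[w].  Left multiplication by [x_i] moves [x_i] past [delta^k], where it becomes
[x_(i-k)], and then merges it with the first letter of [w] if the product of the
two is [delta]. *)
Definition push (i : 'Z_3) (s : state) : state :=
  let j := (i - s.1%:~R)%R in
  if s.2 is h :: t then
    if h == (j + 1)%R then (s.1 + 1, t)%R else (s.1, j :: s.2)
  else (s.1, [:: j]).

(** Left multiplication by [x_i^-1], which is [x_(i+1) delta^-1]. *)
Definition pull (i : 'Z_3) (s : state) : state :=
  push (i + 1)%R (s.1 - 1, s.2)%R.

Lemma push_reduced i (s : state) : reduced s.2 -> reduced (push i s).2.
Proof.
case: s => k [|h t] //= red_s; rewrite /push /=.
by case: eqP => [_|/eqP nh] /=; [apply: path_sorted red_s | rewrite nh].
Qed.

Lemma push_size i (s : state) : (size (push i s).2 <= (size s.2).+1)%N.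
Proof.
by case: s => k [|h t] //=; rewrite /push /=; case: eqP => //= _; lia.
Qed.

Lemma push_shift i k w : push (i + 1)%R (k - 1, w)%R =
  ((push (i + 1 + 1)%R (k, w)).1 - 1, (push (i + 1 + 1)%R (k, w)).2)%R.
Proof.
have ij : (i + 1 - (k - 1)%:~R = i + 1 + 1 - k%:~R :> 'Z_3)%R.
  by rewrite intrD rmorphN opprD opprK addrA addrAC.
rewrite /push /= ij.
by case: w => [|h t] //=; case: eqP => //= _; rewrite addrNK addrK.
Qed.

(** The relation [x_i x_(i+1) = delta] holds in the action.  When the inner
multiplication merges its letter with the first letter of the word, the outer one
must put that letter back, which relies on the word being reduced. *)
Lemma push2 i (s : state) : reduced s.2 ->
  push i (push (i + 1)%R s) = (s.1 + 1, s.2)%R.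
Proof.
case: s => k w /= red_w; rewrite {2}/push /=.
set j := (i - k%:~R)%R.
have -> : (i + 1 - k%:~R = j + 1)%R by rewrite addrAC.
case: w red_w => [|h t] red_w.
  by rewrite /push /= -/j eqxx.
case: eqP => [hj|_]; last by rewrite /push /= -/j eqxx.
have ej : (i - (k + 1)%:~R = j - 1)%R by rewrite intrD opprD addrA.
(* The letter merged is [j + 2 = j - 1]. *)
have hE : h = (j - 1)%R by rewrite hj -{2}(Z3_succ3 j) !addrK.
rewrite /push /= ej -hE; case: t red_w => [|h' t] //= /andP[nh' _].
by rewrite (negbTE nh').
Qed.

Lemma pushK i (s : state) : reduced s.2 -> pull i (push i s) = s.
Proof.
move=> red_s; rewrite /pull push_shift -surjective_pairing.
have := push2 (i + 1 + 1)%R red_s; rewrite Z3_succ3 => ->.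
by case: s {red_s} => k w /=; rewrite addrK.
Qed.

Lemma pullK i (s : state) : reduced s.2 -> push i (pull i s) = s.
Proof.
move=> red_s; rewrite /pull push2 //=.
by case: s {red_s} => k w; rewrite /= addrNK.
Qed.

Definition run_letter (l : bkl_index 3 * bool) : state -> state :=
  if l.2 then push (code l.1) else pull (code l.1).

Definition run w (s : state) : state := foldr run_letter s w.

Lemma run_cat w w' (s : state) : run (w ++ w') s = run w (run w' s).
Proof. exact: foldr_cat. Qed.

Lemma run_reduced w (s : state) : reduced s.2 -> reduced (run w s).2.
Proof.
by elim: w => //= -[i []] w IH /IH red_s; apply: push_reduced.
Qed.

Lemma run_size w (s : state) : (size (run w s).2 <= size s.2 + size w)%N.
Proof.
elim: w => [|[i e] w IH] /=; first by rewrite addn0.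
rewrite addnS; apply: (@leq_trans (size (run w s).2).+1) => //.
by case: e; apply: push_size.
Qed.

Lemma cong_run w w' : cong (group_rel (@bkl_rel 3)) w w' ->
  forall s : state, reduced s.2 -> run w s = run w' s.
Proof.
elim=> {w w'}.
- move=> _ _ [_ _ /bkl_rel3[i [j [-> ->]]]|i []] s red_s /=.
  + by rewrite /run_letter /= !genK !push2.
  + exact: pullK.
  + exact: pushK.
- by [].
- by move=> w w' _ IH s red_s; rewrite IH.
- by move=> u v w _ IH1 _ IH2 s red_s; rewrite IH1 ?IH2.
- move=> u u' v v' _ IHu _ IHv s red_s.
  by rewrite !run_cat IHv // IHu //; apply: run_reduced.
Qed.

(** The normal form of [g], as its action on the trivial state. *)
Definition nf (g : G) : state := run (repr g) (0%R, [::]).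

Lemma nf_word w : nf (word w) = run w (0%R, [::]).
Proof. by apply: cong_run => //; apply: cong_repr. Qed.

Lemma nf_wordM w g : nf (word w * g) = run w (nf g).
Proof. by rewrite -(word_repr g) wordM !nf_word run_cat. Qed.

Lemma nf_reduced g : reduced (nf g).2.
Proof. exact: run_reduced. Qed.

Lemma nf_size g : (size (nf g).2 <= len g)%N.
Proof.
have [[w <- <-] _] := lenP g.
by rewrite nf_word; apply: leq_trans (run_size _ _) _.
Qed.

Definition prod_x (w : seq 'Z_3) : M := \prod_(i <- w) x_ i.

Lemma nf_xM i p : nf (embed (x_ i * p)) = push i (nf (embed p)).
Proof.
by rewrite embedM /x_ /atom embed_wclass nf_wordM /= /run_letter /= genK.
Qed.

(** A positive element can be read off its normal form, whose power of [delta]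
is nonnegative.  In particular the normal form determines the element within the
monoid. *)
Lemma nf_embed p : exists k, (nf (embed p)).1 = Posz k /\
  p = delta 3 ^+ k * prod_x (nf (embed p)).2.
Proof.
elim/x_ind: p => [|i p].
  exists 0%N; rewrite embed1 -(_ : word [::] = 1) // nf_word /=.
  by rewrite /prod_x big_nil mulg1.
rewrite nf_xM; case: (nf _) => _ w [k [/= -> ->]]; rewrite mulgA.
have -> : x_ i * delta 3 ^+ k = delta 3 ^+ k * x_ (i - k%:R)%R.
  by rewrite -x_deltaX subrK.
rewrite -mulgA /push /= -pmulrn /prod_x; set j := (i - _)%R.
case: w => [|h t]; first by exists k; rewrite /= !big_cons.
case: eqP => [->|_] /=; last by exists k; rewrite (big_cons _ _ j).
exists k.+1; split; first lia.
by rewrite big_cons (mulgA (x_ j)) x_succ expgSr mulgA.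
Qed.

Lemma embed_inj : injective (@embed 3).
Proof.
move=> p q pq; have [k [ek ->]] := nf_embed p; have [l [el ->]] := nf_embed q.
by move: ek el; rewrite pq => -> [->].
Qed.

(** * Divisibility and left gcds on three strings *)

Lemma bkl3_mulI (p q r : M) : p * q = p * r -> q = r.
Proof.
by move=> pq; apply/embed_inj/(mulgI (embed p)); rewrite -!embedM pq.
Qed.

Lemma ldvd_mul2l (p q r : M) : ldvd (p * q) (p * r) -> ldvd q r.
Proof. by move=> [c]; rewrite -mulgA => /bkl3_mulI; exists c. Qed.

Lemma ldvd_mul (p q r : M) : ldvd q r -> ldvd (p * q) (p * r).
Proof. by move=> [c <-]; exists c; rewrite mulgA. Qed.

Lemma x_dvd_nf i p : ldvd (x_ i) p ->
  ldvd (delta 3) p \/ exists t, nf (embed p) = (0%R, i :: t).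
Proof.
move=> [q qp]; have [[|k] [/= k0 pE]] := nf_embed p; last first.
  left; rewrite pE expgS -mulgA; by eexists.
right; move: k0; have [k [kE _]] := nf_embed q.
rewrite -qp nf_xM; case: (nf _) kE => _ w /= ->.
rewrite /push /=; case: w => [|h t] /=; last case: eqP => _ /=; last first.
- by move=> [->]; rewrite subr0; exists (h :: t).
- lia.
- by move=> [->]; rewrite subr0; exists [::].
Qed.

(** If [delta] does not divide [p], the normal form of [p] is a word, and the only
atom dividing [p] is its first letter. *)
Lemma two_x_dvd i j p : i <> j ->
  ldvd (x_ i) p -> ldvd (x_ j) p -> ldvd (delta 3) p.
Proof.
move=> ij /x_dvd_nf[//|[t ti]] /x_dvd_nf[//|[t' tj]].
by case: ij; move: tj; rewrite ti => -[].
Qed.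

Lemma ldvd_refl (p : M) : ldvd p p. Proof. by exists 1; rewrite mulg1. Qed.

Lemma ldvd1 (p : M) : ldvd 1 p. Proof. by exists p; rewrite mul1g. Qed.

(** By induction on the degree.  If [x_i] divides [p = x_i p'] and
[q = x_i q'], the gcd is [x_i] times that of [p'] and [q'].  The delicate case is
a common divisor [x_j e'] with [j <> i]: then [delta] divides [p] and [q], and
the candidates [x_i gcd (p', q')] and [x_j gcd (x_j^-1 p, x_j^-1 q)] agree, both
being [delta] times the gcd of [delta^-1 p] and [delta^-1 q]. *)
Lemma ex_lgcd (p q : M) : exists d, is_lgcd p q d.
Proof.
have [n] := ubnP (deg p); elim: n p q => // n IH p q; rewrite ltnS => len_p.
have [[i [[p' pE] [q' qE]]]|none] :=
  pselect (exists i, ldvd (x_ i) p /\ ldvd (x_ i) q); last first.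
  exists 1; split; [exact: ldvd1|exact: ldvd1|move=> e ep eq].
  have [->|/x_divisor[i ie]] := pselect (e = 1); first exact: ldvd_refl.
  by case: none; exists i; split; apply: ldvd_trans ie _.
have deg_x j (r : M) : deg (x_ j * r) = (deg r).+1 by rewrite degM deg_atom.
have [d [dp dq dmax]] : exists d, is_lgcd p' q' d.
  by apply: IH; rewrite -ltnS -(deg_x i) pE.
exists (x_ i * d); rewrite -{}pE -{}qE in len_p *.
split; [exact: ldvd_mul|exact: ldvd_mul|move=> e ep eq].
have [->|] := pselect (e = 1); first exact: ldvd1.
move=> /x_divisor[j [e' eE]]; rewrite -{}eE in ep eq *.
have [ij|ij] := pselect (i = j).
  rewrite -ij in ep eq *; apply/ldvd_mul/dmax.
    exact: ldvd_mul2l ep.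
  exact: ldvd_mul2l eq.
have x_self k (r s : M) : ldvd (x_ k * r) s -> ldvd (x_ k) s.
  by apply: ldvd_trans; exists r.
have [p2 p2E] : ldvd (delta 3) (x_ i * p').
  by apply: (two_x_dvd ij); [exists p' | apply: x_self ep].
have [q2 q2E] : ldvd (delta 3) (x_ i * q').
  by apply: (two_x_dvd ij); [exists q' | apply: x_self eq].
have lift k (r : M) : delta 3 * r = x_ k * (x_ (k + 1)%R * r).
  by rewrite mulgA x_succ.
have p'E : p' = x_ (i + 1)%R * p2.
  by apply: (@bkl3_mulI (x_ i)); rewrite -lift p2E.
have q'E : q' = x_ (i + 1)%R * q2.
  by apply: (@bkl3_mulI (x_ i)); rewrite -lift q2E.
have [d' d'E] : ldvd (x_ (i + 1)%R) d.
  by apply: dmax; rewrite ?p'E ?q'E; eexists.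
(* Now [d = x_(i+1) d'], and [d'] is a gcd of [p2] and [q2]. *)
rewrite -d'E -lift (lift j).
have [c [cp cq cmax]] : exists c,
    is_lgcd (x_ (j + 1)%R * p2) (x_ (j + 1)%R * q2) c.
  by apply: IH; move: len_p; rewrite p'E !deg_x.
have e'c : ldvd e' c.
  by apply: cmax; apply: (@ldvd_mul2l (x_ j)); rewrite -lift ?p2E ?q2E.
apply: ldvd_mul; apply: ldvd_trans e'c _.
have [c' c'E] : ldvd (x_ (j + 1)%R) c by apply: cmax; eexists.
rewrite -c'E in cp cq *; apply: ldvd_mul.
apply: (@ldvd_mul2l (x_ (i + 1)%R)); rewrite d'E; apply: dmax.
- by rewrite p'E; apply/ldvd_mul/ldvd_mul2l/cp.
- by rewrite q'E; apply/ldvd_mul/ldvd_mul2l/cq.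
Qed.

Lemma lgcd1_coprime (u v : M) : lgcd u v = 1 ->
  forall i, ldvd (x_ i) u -> ldvd (x_ i) v -> False.
Proof.
move=> uv1 i iu iv; have [_ _ maxd] := lgcdP (ex_lgcd u v).
have := ldvd_deg (maxd _ iu iv).
by rewrite uv1 deg1 deg_atom.
Qed.

(** * Irreducible fractions and their length *)

(** Powers of [delta] suffice as denominators, since [delta] permutes the atoms
by conjugation and every atom divides it. *)
Lemma braid_fraction_delta (g : G) : exists (m : nat) (v : M),
  g = (embed (delta 3 ^+ m))^-1 * embed v.
Proof.
have x_shift i n : embed (x_ i) * (embed (delta 3 ^+ n))^-1 =
    (embed (delta 3 ^+ n))^-1 * embed (x_ (i + n%:R)%R).
  apply: (mulgI (embed (delta 3 ^+ n))); rewrite !mulgA mulgV mul1g.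
  by rewrite -embedM -x_deltaX embedM mulgK.
rewrite -(word_repr g); elim: (repr g) => [|[a e] w [m [v IH]]].
  by exists 0%N, 1; rewrite embed1 invg1 mul1g.
rewrite -cat1s -wordM {}IH mulgA; case: e.
  exists m, (x_ (code a + m%:R)%R * v).
  by rewrite embedM !mulgA -x_shift /x_ codeK embed_wclass.
exists m.+1, (x_ (code a + 1 + m.+1%:R)%R * v).
rewrite embedM !mulgA -x_shift; congr (_ * _).
have -> : word [:: (a, false)] = (embed (x_ (code a)))^-1.
  by rewrite /x_ codeK embed_wclass wordV.
rewrite expgSr embedM invgM mulgA; congr (_ * _).
apply: (mulgI (embed (x_ (code a)))).
by rewrite mulgV mulgA -embedM x_succ mulgV.
Qed.

Lemma ex_irreducible (g : G) : exists uv : M * M,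
  g = (embed uv.1)^-1 * embed uv.2 /\ lgcd uv.1 uv.2 = 1.
Proof.
have [m [v ->]] := braid_fraction_delta g; move: (delta 3 ^+ m) => u.
have [d [[u' uE] [v' vE] dmax]] := ex_lgcd u v; exists (u', v'); split=> /=.
  by rewrite -uE -vE !embedM invgM -mulgA mulKg.
have [eu ev _] := lgcdP (ex_lgcd u' v'); set e := lgcd u' v' in eu ev *.
apply: deg_eq0; apply/eqP; rewrite -leqn0 -(leq_add2l (deg d)) addn0 -degM.
by apply/ldvd_deg/dmax; rewrite -?uE -?vE; apply: ldvd_mul.
Qed.

Definition x_word (w : seq 'Z_3) : seq (bkl_index 3) := map gen w.

Lemma prod_xE w : prod_x w = wclass (@bkl_rel 3) (x_word w).
Proof.
elim: w => [|i w IH]; first by rewrite /prod_x big_nil.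
by rewrite /prod_x big_cons -/(prod_x w) IH [LHS]pmulE.
Qed.

(** When [x_i^-1] acts on [(-m, t)] without cancellation, it prepends the letter
[i + m + 2] and gives a state with [-(m + 1)].  The next letter [i'] of the
inverse word would cancel only against [i' + m + 1], that is, if
[i' = i + 1], which is excluded in a reduced word. *)
Lemma run_flip w (m : nat) t : reduced w ->
  (if w is i :: _ then
     if t is h :: _ then h != (i + m%:R)%R else true
   else true) ->
  size (run (flip_word (pos_word (x_word w))) (- Posz m, t)%R).2 =
  (size t + size w)%N.
Proof.
elim: w m t => [|i w IH] m t; first by rewrite addn0.
move=> red_w apart; rewrite -[i :: w]cat1s /x_word map_cat /pos_word map_cat.
rewrite /flip_word map_cat rev_cat run_cat /= /run_letter /= genK.
have shift : (- Posz m - 1 = - Posz m.+1)%R by lia.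
have jE : (i + 1 - (- Posz m.+1)%:~R = i + m%:R + 1 + 1 :> 'Z_3)%R.
  rewrite mulrNz opprK -pmulrn -natr1 !addrA.
  by congr (_ + _)%R; rewrite addrAC.
have -> : pull i (- Posz m, t)%R = (- Posz m.+1, (i + m%:R + 1 + 1) :: t)%R.
  rewrite /pull /push /= shift jE Z3_succ3.
  by case: t apart => [|h t] //= /negbTE ->.
rewrite IH /= ?addnS ?addSn //; first exact: path_sorted red_w.
case: w red_w {IH} => [|i' w] //= /andP[ne _].
apply: contraNneq ne => E.
apply/eqP/(addIr m.+1%:R%R); rewrite -E -natr1 !addrA -!addrA.
by rewrite (addrCA 1%R).
Qed.

(** If [u] or [v] is trivial, the exponent sum gives the bound; otherwise [u] and
[v] are given by words with distinct first letters, and no cancellation occurs in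
the normal form of [u^-1 v]. *)
Lemma coprime_len (u v : M) :
  (forall i, ldvd (x_ i) u -> ldvd (x_ i) v -> False) ->
  (deg u + deg v <= len ((embed u)^-1 * embed v)%g)%N.
Proof.
move=> coprime.
have := len_fraction_ge u v.
have [->|u1] := pselect (u = 1); first by rewrite deg1; lia.
have [->|v1] := pselect (v = 1); first by rewrite deg1; lia.
move=> _; apply: leq_trans (nf_size _).
have [i iu] := x_divisor u1; have [j jv] := x_divisor v1.
case: (x_dvd_nf iu) => [du|[w uE]].
  by case: (coprime j) => //; apply: ldvd_trans du; apply: x_dvd_delta.
case: (x_dvd_nf jv) => [dv|[t vE]].
  by case: (coprime i) => //; apply: ldvd_trans dv; apply: x_dvd_delta.
have prodE (p : M) (r : seq 'Z_3) : nf (embed p) = (0%R, r) -> p = prod_x r.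
  move=> pE; have [k [kE ->]] := nf_embed p.
  by move: kE; rewrite pE => -[<-]; rewrite mul1g.
have deg_prod (r : seq 'Z_3) : deg (prod_x r) = size r.
  by rewrite prod_xE deg_wclass size_map.
rewrite {1}(prodE _ _ uE) {1}(prodE _ _ vE) !deg_prod.
rewrite (prodE _ _ uE) prod_xE embed_wclass wordV nf_wordM vE.
have red_u := nf_reduced (embed u); rewrite uE in red_u.
rewrite (@run_flip (i :: w) 0 (j :: t)) //; first by rewrite addnC.
rewrite addr0; apply/eqP => ji; apply: (coprime i) => //; by rewrite -ji.
Qed.

Theorem corollary18 : forall x : braid 3, rational_len x = len x.
Proof.
move=> x; rewrite /rational_len /rational_nf.
have [] := xgetPex (1, 1) (ex_irreducible x).
rewrite -/(irreducible_fraction x).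
case: (irreducible_fraction x) => u v /= -> coprime_uv.
have atom_dvd i : ldvd (atom i) (delta 3).
  by rewrite -(codeK i); apply: x_dvd_delta.
rewrite !greedy_nf_len //; try exact: ex_lgcd.
apply/eqP; rewrite eqn_leq len_fraction_le andbT.
exact/coprime_len/lgcd1_coprime.
Qed.
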